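(* Let $n\ge3$, $m\ge2$. The quantum cluster $R$-matrices on $y$-variables $R_{M_1}^\epsilon,\dots,R_{M_{m-1}}^\epsilon:\mathcal{Y}_\epsilon\to\mathcal{Y}_\epsilon$ satisfy $R_{M_j}^\epsilon R_{M_{j+1}}^\epsilon R_{M_j}^\epsilon=R_{M_{j+1}}^\epsilon R_{M_j}^\epsilon R_{M_{j+1}}^\epsilon$ for $1\le j\le m-2$ and $(R_{M_j}^\epsilon)^2=\mathrm{id}$ for $1\le j\le m-1$. Furthermore, $R_{M_i}^\epsilon R_{M_j}^\epsilon=R_{M_j}^\epsilon R_{M_i}^\epsilon$ whenever $|i-j|>1$. Thus the $R_{M_j}^\epsilon$ generate an action of $\mathfrak{S}_m$ on $\mathcal{Y}_\epsilon$.
   Context: Second indices are taken in $\mathbb{Z}/n\mathbb{Z}$, and $\epsilon$ is a central indeterminate. $\mathcal{Y}_\epsilon$ is the skew field of fractions of the quantum torus over $\mathbb{Z}[\epsilon,\epsilon^{-1}]$ generated by $y_{j,i}^{\pm1}$ ($0\le j\le m$, $i\in\mathbb{Z}/n\mathbb{Z}$) with relations $$y_{j,i}y_{j+1,i}=\epsilon^2y_{j+1,i}y_{j,i},\quad y_{j,i}y_{j+1,i-1}=\epsilon^{-2}y_{j+1,i-1}y_{j,i}\quad(0\le j\le m-1),\qquad y_{j,i}y_{j,i+1}=\epsilon^{-2}y_{j,i+1}y_{j,i}\quad(0\le j\le m),$$ all other pairs of generators commuting. For $1\le j\le m-1$ put $\alpha_i^\epsilon=\alpha_i^\epsilon(M_j)=1+\sum_{k=1}^{n-1}\epsilon^k\,y_{j,i}y_{j,i+1}\cdots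 y_{j,i+k-1}$. The quantum cluster $R$-matrix $R_{M_j}^\epsilon:\mathcal{Y}_\epsilon\to\mathcal{Y}_\epsilon$ is the morphism of skew fields fixing $\epsilon$ with $$R_{M_j}^\epsilon(y_{j,i})=(\alpha_{i+2}^\epsilon)^{-1}y_{j,i+1}^{-1}\alpha_i^\epsilon,\quad R_{M_j}^\epsilon(y_{j-1,i})=(\alpha_i^\epsilon)^{-1}\epsilon\,y_{j,i}y_{j-1,i}\,\alpha_{i+1}^\epsilon,\quad R_{M_j}^\epsilon(y_{j+1,i})=(\alpha_{i+1}^\epsilon)^{-1}\epsilon\,y_{j,i+1}y_{j+1,i}\,\alpha_{i+2}^\epsilon,$$ and fixing $y_{j',i}$ for $j'\notin\{j-1,j,j+1\}$. Products denote composition. *)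

(* Defs.v *)
From mathcomp Require Import all_boot all_order all_algebra all_fingroup.

Set Implicit Arguments.
Unset Strict Implicit.
Unset Printing Implicit Defensive.

Import GRing.Theory.
Local Open Scope ring_scope.

(* A family of generators y_{j,i} is a function [y : nat -> 'Z_n -> S] of     *)
(* which only the rows [j <= m] matter; the values on the other rows are      *)
(* unconstrained junk. 'Z_n is the ring Z/nZ as soon as 1 < n.                *)

(* [listed_pair (j, i) (k, l)]: the pair y_{j,i}, y_{k,l}, in this order, is  *)
(* the left-hand side of one of the three q-commutation relations.            *)
Definition listed_pair (n : nat) (p r : nat * 'Z_n) : bool :=
  [|| (r.1 == p.1.+1) && (r.2 == p.2),
      (r.1 == p.1.+1) && (r.2 == p.2 - 1)
    | (r.1 == p.1) && (r.2 == p.2 + 1)].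

(* The pair (S, q) with q a central unit is a Z[q,q^-1]-algebra.              *)
Record torus_family (n m : nat) (S : unitRingType) (q : S)
    (y : nat -> 'Z_n -> S) : Prop := TorusFamily {
  torus_q_unit : q \is a GRing.unit;
  torus_q_central : forall s : S, GRing.comm q s;
  torus_y_unit : forall j i, (j <= m)%N -> y j i \is a GRing.unit;
  torus_rel_same : forall j i, (j < m)%N ->
    y j i * y j.+1 i = q ^+ 2 * (y j.+1 i * y j i);
  torus_rel_prev : forall j i, (j < m)%N ->
    y j i * y j.+1 (i - 1) = q ^- 2 * (y j.+1 (i - 1) * y j i);
  torus_rel_row : forall j i, (j <= m)%N ->
    y j i * y j (i + 1) = q ^- 2 * (y j (i + 1) * y j i);
  torus_rel_comm : forall j i k l, (j <= m)%N -> (k <= m)%N ->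
    ~~ listed_pair (j, i) (k, l) -> ~~ listed_pair (k, l) (j, i) ->
    GRing.comm (y j i) (y k l)
}.

(* The Z[q,q^-1]-algebra presented by the generators y_{j,i}^{+-1} (j <= m)   *)
(* and the above relations, described by its universal property.              *)
Definition quantum_torus (n m : nat) (T : unitRingType) (q : T)
    (y : nat -> 'Z_n -> T) : Prop :=
  torus_family m q y /\
  forall (S : unitRingType) (e : S) (z : nat -> 'Z_n -> S),
    torus_family m e z ->
    let extends (f : {rmorphism T -> S}) :=
      f q = e /\ forall j i, (j <= m)%N -> f (y j i) = z j i in
    exists2 f : {rmorphism T -> S},
      extends f & forall g : {rmorphism T -> S}, extends g -> g =1 f.

(* Y, together with iota, is the skew field of (right) fractions of T.        *)
Definition skew_field_of_fractions (T Y : unitRingType)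
    (iota : {rmorphism T -> Y}) : Prop :=
  [/\ forall z : Y, z != 0 -> z \is a GRing.unit,
      injective iota
    & forall z : Y, exists a b : T, b != 0 /\ z = iota a * (iota b)^-1].

(* The factors of the (noncommutative) product are taken from left to right.  *)
Definition alpha (n : nat) (Y : unitRingType) (q : Y) (y : nat -> 'Z_n -> Y)
    (j : nat) (i : 'Z_n) : Y :=
  1 + \sum_(1 <= k < n) q ^+ k * \prod_(0 <= l < k) y j (i + l%:R).

(* Used for 1 <= j <= m - 1 only, so that j.-1 is a true predecessor and      *)
(* j.+1 <= m.                                                                 *)
Record quantum_R_matrix (n m : nat) (Y : unitRingType) (q : Y)
    (y : nat -> 'Z_n -> Y) (j : nat) (R : {rmorphism Y -> Y}) : Prop :=
  QuantumRMatrix {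
  R_q : R q = q;
  R_mid : forall i, R (y j i) =
    (alpha q y j (i + 2))^-1 * (y j (i + 1))^-1 * alpha q y j i;
  R_prev : forall i, R (y j.-1 i) =
    (alpha q y j i)^-1 * (q * y j i * y j.-1 i) * alpha q y j (i + 1);
  R_next : forall i, R (y j.+1 i) =
    (alpha q y j (i + 1))^-1 * (q * y j (i + 1) * y j.+1 i)
      * alpha q y j (i + 2);
  R_other : forall k i, (k <= m)%N -> k \notin [:: j.-1; j; j.+1] ->
    R (y k i) = y k i
}.

(* Main.v *)
From HB Require Import structures.
Require Import Defs.
From mathcomp Require Import all_boot all_order all_algebra all_fingroup.
From mathcomp Require Import ring zify.

Set Implicit Arguments.
Unset Strict Implicit.
Unset Printing Implicit Defensive.

Import Order.TTheory GRing.Theory Num.Theory.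
Local Open Scope ring_scope.

(** Write u_{k,i} = q y_{k,i} and let X_{k,i} = u_{m,i} u_{m-1,i} ... u_{k,i} be
    the partial product of column i. In these coordinates R_j becomes a change
    of factorization. It fixes X_k for k different from j and j+1, and for
    b = X_j, a = X_{j+1} it gives
      R_j b_i = al_{i+1}^-1 a_i al_i,
      R_j a_i = al_{i+1}^-1 u_{j,i+1} a_i al_{i+2},
    where al = alpha(M_j). Together with
      a_i al_i = a_i (1 - q^-2 u_{j,i} ... u_{j,i+n-1}) + al_{i+1} b_i
    ([alpha_column]) and the fact that b_{i+1} a_i commutes with row j, this
    shows that b_i + a_i and b_{i+1} a_i are fixed by R_j ([R_column_sum],
    [R_column_mul]). These are the coefficients of L_b L_a, where
      (L_v psi)_t = psi_t + v_{-t} psi_{t+1}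
    acts on sequences with values in Y. Hence every composite of the R_j
    preserves the operator L_{X_1} ... L_{X_m}.

    The holonomy h_k = X_{k,i} X_{k,i-1} ... X_{k,i-n+1} is central and does not
    depend on i, the h_k are pairwise distinct, and R_j exchanges h_j and
    h_{j+1} ([R_holonomy_row], [R_holonomy_next]).

    A factorization L_{x_1} ... L_{x_m} of a given operator is determined by the
    ordered list of its holonomies, if these are central and distinct
    ([transfer_unique]): a sequence which is killed by the whole product and has
    the quasi-period attached to the last holonomy must be killed by the last
    factor, because no other factor has a kernel of that quasi-period; and a
    sequence of units killed by L_v determines v.

    So a composite of the R_j is determined by the permutation that it induces
    on h_1, ..., h_m ([permutes_rows_inj]). The involution, braid and
    commutation relations then reduce to equalities of permutations, and choosing
    for each permutation one composite inducing it gives the action, without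
    appeal to a presentation of the symmetric group.

    That alpha is invertible and that the holonomies are distinct is seen at a
    commutative point of the torus, where q = 1 and every y_{k,i} = 2. *)

(** * Factorizations into first-order operators *)

(** The index of [x] runs backwards so that sequences can be indexed by [nat]
    and a shift of the sequence by one lowers the index of [x] by one. *)
Definition elem_op (n : nat) (S : pzRingType) (x : 'Z_n -> S) (psi : nat -> S)
    (t : nat) : S :=
  psi t + x (- t%:R) * psi t.+1.

(** The factor of index [0] is applied last, so that recursion on [K] peels off
    the innermost factor. *)
Fixpoint transfer (n : nat) (S : pzRingType) (x : nat -> 'Z_n -> S) (K : nat)
    (psi : nat -> S) : nat -> S :=
  if K is k.+1 then transfer x k (elem_op (x k) psi) else psi.

Definition holonomy (n : nat) (S : pzRingType) (x : 'Z_n -> S) (i : 'Z_n) : S :=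
  \prod_(0 <= l < n) x (i - l%:R).

Section Transfer.

Variables (n : nat) (S : pzRingType).
Implicit Types (x y : nat -> 'Z_n -> S) (psi phi : nat -> S).

Lemma eq_elem_op (v w : 'Z_n -> S) psi phi :
  v =1 w -> psi =1 phi -> elem_op v psi =1 elem_op w phi.
Proof. by move=> vw eqp t; rewrite /elem_op vw !eqp. Qed.

Lemma eq_transfer x y K psi phi :
    (forall k, (k < K)%N -> x k =1 y k) -> psi =1 phi ->
  transfer x K psi =1 transfer y K phi.
Proof.
elim: K psi phi => [|K IHK] psi phi eqx eqp //=.
apply: IHK => [k ltkK|]; first by apply: eqx; apply: ltnW.
by apply: eq_elem_op => //; apply: eqx.
Qed.

Lemma elem_op0 (v : 'Z_n -> S) : elem_op v (fun=> 0) =1 fun=> 0.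
Proof. by move=> t; rewrite /elem_op mulr0 addr0. Qed.

Lemma transfer0 x K : transfer x K (fun=> 0) =1 fun=> 0.
Proof.
elim: K => [|K IHK] //= t; rewrite -[RHS](IHK t).
by apply: eq_transfer => //; apply: elem_op0.
Qed.

(** The product of two consecutive factors only involves the sums
    [x j i + x j.+1 i] and the products [x j i * x j.+1 (i - 1)]. *)
Lemma eq_transfer_two x y K j :
    (j.+1 < K)%N ->
    (forall k, (k < K)%N -> k != j -> k != j.+1 -> x k =1 y k) ->
    (forall i, x j i + x j.+1 i = y j i + y j.+1 i) ->
    (forall i, x j i * x j.+1 (i - 1) = y j i * y j.+1 (i - 1)) ->
  forall psi, transfer x K psi =1 transfer y K psi.
Proof.
move=> ltjK eqx sum_xy prod_xy; elim: K ltjK eqx => [|K IHK] // ltjK eqx psi.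
move: ltjK; rewrite ltnS leq_eqVlt => /orP[/eqP defK | ltjK] /=; last first.
  move=> t; rewrite IHK //; last by move=> k ltkK; apply: eqx; apply: ltnW.
  apply: eq_transfer => //; apply: eq_elem_op => //; apply: eqx => //; lia.
subst K; rewrite /=; apply: eq_transfer => [k ltkj|t].
  by apply: eqx; lia.
rewrite /elem_op !mulrDr !mulrA !addrA -!(addrA (psi t)) -!mulrDl.
rewrite [x j.+1 _ + _]addrC [y j.+1 _ + _]addrC sum_xy.
have ->: - t.+1%:R = - t%:R - 1 :> 'Z_n by rewrite -[t.+1]addn1 natrD opprD.
by rewrite prod_xy.
Qed.

(** [c] multiplies the later term: this avoids an inverse in the quasi-period
    [(-1) ^+ n * holonomy v i] of the kernel of [elem_op v]. *)
Definition quasi_periodic (c : S) psi := forall t, psi t = c * psi (t + n)%N.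

Lemma quasi_periodic_elem_op c (v : 'Z_n -> S) psi :
    (1 < n)%N -> (forall s, GRing.comm c s) ->
  quasi_periodic c psi -> quasi_periodic c (elem_op v psi).
Proof.
move=> n_gt1 cC psiP t; rewrite /elem_op natrD pchar_Zp // addr0.
by rewrite mulrDr -psiP mulrA cC -mulrA -addSn -psiP.
Qed.

Lemma elem_op_kernel (v : 'Z_n -> S) psi t N :
    elem_op v psi =1 (fun=> 0) ->
  psi t = (-1) ^+ N * \prod_(0 <= l < N) v (- t%:R - l%:R) * psi (t + N)%N.
Proof.
move=> ker; elim: N => [|N IHN]; first by rewrite big_nil expr0 !mul1r addn0.
have step: psi (t + N)%N = - (v (- t%:R - N%:R) * psi (t + N).+1).
  by apply/eqP; rewrite -addr_eq0 -opprD -natrD; apply/eqP/ker.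
rewrite IHN step big_nat_recr //= addnS exprS mulN1r.
by rewrite !mulrN !mulNr !mulrA.
Qed.

End Transfer.

Section Uniqueness.

Variables (n : nat) (S : unitRingType).
Hypothesis n_gt1 : (1 < n)%N.
Hypothesis divS : forall z : S, z != 0 -> z \is a GRing.unit.
Implicit Types (x y : nat -> 'Z_n -> S) (psi phi : nat -> S).

(** On sequences of quasi-period [c] each factor [elem_op (x k)] is injective:
    iterating [psi t = - x k (- t) * psi t.+1] over one period yields
    [(c - (-1) ^+ n * holonomy (x k) (- t)) * psi (t + n) = 0]. *)
Lemma transfer_kernel x K c psi :
    (forall s, GRing.comm c s) ->
    (forall k i, (k < K)%N -> (-1) ^+ n * holonomy (x k) i != c) ->
    quasi_periodic n c psi -> transfer x K psi =1 (fun=> 0) ->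
  psi =1 (fun=> 0).
Proof.
move=> cC; elim: K psi => [|K IHK] psi // neq_c psiP /= ker0.
have {ker0} ker: elem_op (x K) psi =1 (fun=> 0).
  apply: IHK ker0 => [k i ltkK|]; first by apply: neq_c; apply: ltnW.
  exact: quasi_periodic_elem_op.
move=> t; have:= elem_op_kernel t n ker; rewrite -/(holonomy _ _) {1}psiP.
move/eqP; rewrite -subr_eq0 -mulrBl => /eqP eq0.
have: c - (-1) ^+ n * holonomy (x K) (- t%:R) \is a GRing.unit.
  by apply: divS; rewrite subr_eq0 eq_sym neq_c.
by move/mulrI=> inj; rewrite psiP [psi _](inj _ 0) ?mulr0.
Qed.

(** First-order recurrences with unit coefficients can be solved forward from
    any initial value, whence the surjectivity of [elem_op]. *)
Fixpoint elem_op_preim (v : 'Z_n -> S) phi (z0 : S) (t : nat) : S :=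
  if t is t'.+1 then (v (- t'%:R))^-1 * (phi t' - elem_op_preim v phi z0 t')
  else z0.

Lemma elem_op_preimK (v : 'Z_n -> S) phi z0 :
  (forall i, v i \is a GRing.unit) ->
  elem_op v (elem_op_preim v phi z0) =1 phi.
Proof.
by move=> uv t; rewrite /elem_op /= mulVKr // addrC subrK.
Qed.

(** The kernel [psi] of the innermost factor of [y] is killed by the product for
    [x], and its quasi-period is not that of a factor [x k] with [k < K]; so it
    is killed by the innermost factor of [x], which therefore is that of [y].
    This factor is surjective, hence can be cancelled. *)
Theorem transfer_unique x y K :
    (forall k i, (k < K)%N -> x k i \is a GRing.unit) ->
    (forall k i, (k < K)%N -> y k i \is a GRing.unit) ->
    (forall k i i', (k < K)%N -> holonomy (x k) i = holonomy (y k) i') ->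
    (forall k i s, (k < K)%N -> GRing.comm (holonomy (x k) i) s) ->
    (forall k l i, (k < l < K)%N -> holonomy (x k) i != holonomy (x l) i) ->
    (forall psi, transfer x K psi =1 transfer y K psi) ->
  forall k, (k < K)%N -> x k =1 y k.
Proof.
elim: K => [|K IHK] // ux uy hol_xy holC hol_inj eqT.
have hol_x k i : (k < K.+1)%N -> holonomy (x k) i = holonomy (x k) 0.
  by move=> ltk; rewrite (hol_xy k i 0) // (hol_xy k 0 0).
have eqK : x K =1 y K.
  pose psi := elem_op_preim (y K) (fun=> 0) 1.
  have ker: elem_op (y K) psi =1 (fun=> 0).
    by apply: elem_op_preimK => i; apply: uy.
  have upsi t : psi t \is a GRing.unit.
    elim: t => [|t IHt]; first exact: unitr1.
    by rewrite /psi /= sub0r unitrMr ?unitrV ?uy // unitrN.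
  pose c := (-1) ^+ n * holonomy (x K) 0.
  have cC s : GRing.comm c s.
    by apply/commr_sym/commrM; [exact: commr_sign | apply/commr_sym/holC].
  have psiP : quasi_periodic n c psi.
    move=> t; rewrite [LHS](elem_op_kernel t n ker) -/(holonomy _ _).
    by rewrite -(hol_xy K 0).
  have ker_x : elem_op (x K) psi =1 (fun=> 0).
    apply: (@transfer_kernel x K c) => //.
    - move=> k i ltkK; rewrite hol_x ?(leq_trans ltkK) ?leqnSn // /c.
      apply: contra_neq (hol_inj k K 0 _) => [|]; last by rewrite ltkK ltnSn.
      by apply/mulrI; rewrite unitrX ?unitrN1.
    - exact: quasi_periodic_elem_op.
    move=> t; have /= -> := eqT psi t; rewrite -[RHS](transfer0 y K t).
    exact: eq_transfer.
  move=> i; have def_i: i = - (val (- i))%:R by rewrite natr_Zp opprK.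
  rewrite def_i; set t := val _.
  apply: (mulIr (upsi t.+1)); apply: (addrI (psi t)).
  by rewrite -[LHS]/(elem_op _ _ _) ker_x -[RHS]/(elem_op _ _ _) ker.
move=> k; rewrite ltnS leq_eqVlt => /orP[/eqP-> // | ltkK].
apply: IHK k ltkK => [k i ltk|k i ltk|k i i' ltk|k i s ltk|k l i ltkl|psi t].
- by apply: ux; apply: ltnW.
- by apply: uy; apply: ltnW.
- by apply: hol_xy; apply: ltnW.
- by apply: holC; apply: ltnW.
- by apply: hol_inj; lia.
have uxK i : x K i \is a GRing.unit by apply: ux.
have:= eqT (elem_op_preim (x K) psi 0) t; rewrite /=.
rewrite (eq_transfer (y := x) (phi := psi)) //; last exact: elem_op_preimK.
move=> ->; apply: eq_transfer => // s; rewrite -[RHS](elem_op_preimK psi 0 uxK).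
exact: eq_elem_op.
Qed.

End Uniqueness.

(** * Commutation up to powers of a central unit *)

Section QCommutation.

Variables (S : unitRingType) (e : S).
Hypotheses (eU : e \is a GRing.unit) (eC : forall s, GRing.comm e s).

Definition qcomm (d : int) (s t : S) : Prop := s * t = e ^ d * (t * s).

Lemma comm_exprz (d : int) (s : S) : GRing.comm (e ^ d) s.
Proof. exact/commr_sym/commrXz/commr_sym. Qed.

Lemma qcomm_comm s t : qcomm 0 s t <-> GRing.comm s t.
Proof. by rewrite /qcomm expr0z mul1r. Qed.

Lemma qcomm1 t : qcomm 0 1 t.
Proof. exact/qcomm_comm/commr_sym/commr1. Qed.

Lemma qcommM d d' s s' t :
  qcomm d s t -> qcomm d' s' t -> qcomm (d + d') (s * s') t.
Proof.
move=> st s't; rewrite /qcomm -mulrA s't !mulrA -(comm_exprz d').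
rewrite -(mulrA _ s) st.
by rewrite !mulrA -exprzDr // addrC.
Qed.

Lemma qcomm_sym d s t : qcomm d s t -> qcomm (- d) t s.
Proof.
by rewrite /qcomm => ->; rewrite mulrA -exprzDr // addNr expr0z mul1r.
Qed.

Lemma qcomm_central d s t : qcomm d s t -> qcomm d (e * s) (e * t).
Proof.
move=> st; have eM a b : e * a * (e * b) = e * e * (a * b).
  by rewrite mulrA -(mulrA e a) -(eC a) !mulrA.
by rewrite /qcomm !eM st mulrA -(comm_exprz d) -!mulrA.
Qed.

Lemma qcomm_prod (N : nat) (d : nat -> int) (s : nat -> S) t :
    (forall l, (l < N)%N -> qcomm (d l) (s l) t) ->
  qcomm (\sum_(0 <= l < N) d l) (\prod_(0 <= l < N) s l) t.
Proof.
elim: N => [|N IHN] st; first by rewrite !big_nil; apply: qcomm1.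
rewrite !big_nat_recr //=; apply: qcommM; last exact: st.
by apply: IHN => l ltlN; apply/st/ltnW.
Qed.

Definition qprop (s t : S) : Prop := exists d, qcomm d s t.

Lemma qprop_sym s t : qprop s t -> qprop t s.
Proof. by case=> d /qcomm_sym; exists (- d). Qed.

Lemma qprop1 t : qprop 1 t.
Proof. exists 0; exact: qcomm1. Qed.

Lemma qpropM s s' t : qprop s t -> qprop s' t -> qprop (s * s') t.
Proof. by case=> d st [d' s't]; exists (d + d'); apply: qcommM. Qed.

Lemma qprop_prod (N : nat) (s : nat -> S) t :
  (forall l, qprop (s l) t) -> qprop (\prod_(0 <= l < N) s l) t.
Proof.
move=> st; elim: N => [|N IHN]; first by rewrite big_nil; apply: qprop1.
by rewrite big_nat_recr //=; apply: qpropM.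
Qed.

(** Only the existence of the exponent matters here: it cancels when the
    identity is compared with its image under a morphism fixing [e]. *)
Lemma qprop_prod_mul (N : nat) (s t : nat -> S) :
    (forall k l, qprop (s k) (t l)) ->
  exists d : int, \prod_(0 <= l < N) (s l * t l)
    = e ^ d * (\prod_(0 <= l < N) s l * \prod_(0 <= l < N) t l).
Proof.
move=> st; elim: N => [|N [d IHN]].
  by exists 0; rewrite !big_nil expr0z !mulr1.
have [d' td's]: qprop (\prod_(0 <= l < N) t l) (s N).
  by apply: qprop_prod => l; apply: qprop_sym.
exists (d + d'); rewrite !big_nat_recr //= IHN.
set p := \prod_(_ <= _ < _) s _; set r := \prod_(_ <= _ < _) t _ in td's *.
rewrite exprzDr // -!(mulrA (e ^ d)); congr (_ * _).
by rewrite mulrA -(mulrA p) td's mulrA -(comm_exprz d') -!mulrA.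
Qed.

End QCommutation.

Lemma downward_ind (P : nat -> Prop) M :
    P M -> (forall k, (k < M)%N -> P k.+1 -> P k) ->
  forall k, (k <= M)%N -> P k.
Proof.
move=> PM Pstep k lekM; rewrite -(subKn lekM).
elim: (M - k)%N (leq_subr k M) => [|d IHd] ltdM; first by rewrite subn0.
by apply: Pstep; [lia | rewrite subnSK //; apply/IHd/ltnW].
Qed.

(** * Weights of the quantum torus *)

Section CyclicSums.

Variable n : nat.
Hypothesis n_gt1 : (1 < n)%N.

Lemma sum_Zn (V : nmodType) (F : 'Z_n -> V) :
  \sum_(0 <= l < n) F l%:R = \sum_i F i.
Proof.
rewrite -[X in \sum_(0 <= l < X) _](Zp_cast n_gt1) big_mkord.
by apply: eq_bigr => i _; rewrite natr_Zp.
Qed.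

Lemma sum_Zn_shift (V : nmodType) (F : 'Z_n -> V) (i : 'Z_n) :
  \sum_(0 <= l < n) F (i + l%:R) = \sum_i F i.
Proof.
rewrite (sum_Zn (fun j => F (i + j))) [RHS](reindex_inj (addrI i)) //.
Qed.

Lemma sum_Zn_rev (V : nmodType) (F : 'Z_n -> V) (i : 'Z_n) :
  \sum_(0 <= l < n) F (i - l%:R) = \sum_i F i.
Proof.
rewrite (sum_Zn (fun j => F (i - j))) [RHS](reindex_inj (inv_inj (subKr i))) //.
Qed.

Lemma sum_Zn_eq (i : 'Z_n) : \sum_(j : 'Z_n) (j == i)%:R = 1 :> int.
Proof. by rewrite (bigD1 i) //= eqxx big1 ?addr0 // => j /negPf->. Qed.

End CyclicSums.

(** The exponent of [e] when [u j i] is moved past [u k l]. In each of the three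
    terms one column index counts [2] and another [- 2], so that the total
    weight of a row vanishes. *)
Definition weight (n : nat) (j : nat) (i : 'Z_n) (k : nat) (l : 'Z_n) : int :=
  2 * ((k == j.+1)%:R * ((i == l)%:R - (i == l + 1)%:R)
       + (k == j)%:R * ((i == l + 1)%:R - (i == l - 1)%:R)
       + (j == k.+1)%:R * ((i == l - 1)%:R - (i == l)%:R)).

Lemma sum_weight (n : nat) j k (l : 'Z_n) :
  \sum_(i : 'Z_n) weight j i k l = 0.
Proof.
rewrite -mulr_sumr !big_split /= -!mulr_sumr !sumrB !sum_Zn_eq !subrr.
by rewrite !mulr0.
Qed.

Section TorusFamily.

Variables (n m : nat) (S : unitRingType) (e : S) (z : nat -> 'Z_n -> S).
Hypotheses (n_gt2 : (2 < n)%N) (tf : torus_family m e z).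

Let eU := torus_q_unit tf.
Let eC := torus_q_central tf.
Let n_gt1 : (1 < n)%N. Proof. exact: ltnW. Qed.

(** The generators rescaled by [e], which absorbs the powers of [e] in [alpha].
    The lock keeps associativity rewriting from splitting them. *)
Definition gen (j : nat) (i : 'Z_n) : S := locked (e * z j i).

Lemma genE j i : gen j i = e * z j i.
Proof. by rewrite /gen -lock. Qed.

Local Notation u := gen.
Implicit Types (i l : 'Z_n) (j k : nat).

Lemma gen_unit j i : (j <= m)%N -> u j i \is a GRing.unit.
Proof. by move=> lejm; rewrite genE unitrMl ?eU // (torus_y_unit tf). Qed.

Lemma Zn_neq1 (i : 'Z_n) : (i == i + 1) = false.
Proof. by rewrite -subr_eq0 opprD addrA subrr add0r oppr_eq0 oner_eq0. Qed.

Lemma Zn_neq2 (i : 'Z_n) : (i - 1 == i + 1) = false.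
Proof.
rewrite -subr_eq0 -(oppr_eq0 (_ - _)).
have ->: - (i - 1 - (i + 1)) = 2%:R :> 'Z_n by ring.
apply/eqP => /(congr1 (@nat_of_ord _)).
by rewrite (val_Zp_nat n_gt1 2) modn_small.
Qed.

Lemma Zn_eqB1 (i l : 'Z_n) : (i == l - 1) = (l == i + 1).
Proof. by rewrite eq_sym subr_eq. Qed.

Lemma weight_antisym j i k l : weight j i k l = - weight k l j i :> int.
Proof.
rewrite /weight (eq_sym i l) (eq_sym k j) !Zn_eqB1.
set a := (_ == _)%:R; set b := (_ == _)%:R; set c := (_ == _)%:R.
set d := (_ == _)%:R; set f := (_ == _)%:R; set g := (_ == _)%:R.
by ring.
Qed.

Lemma gen_qcomm j i k l :
  (j <= m)%N -> (k <= m)%N -> qcomm e (weight j i k l) (u j i) (u k l).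
Proof.
wlog lejk: j i k l / (j <= k)%N => [IH|] lejm lekm.
  case: (leqP j k) => [|/ltnW] lejk; first exact: IH.
  by rewrite weight_antisym; apply/qcomm_sym/IH.
rewrite !genE; apply: qcomm_central => //; rewrite /weight.
have -> : (j == k.+1) = false by apply/eqP; lia.
rewrite mul0r addr0.
have [def_k|neq_kj1] := eqVneq k j.+1.
  rewrite {k lejk}def_k in lekm *.
  have -> : (j.+1 == j) = false by apply/eqP; lia.
  rewrite mul0r addr0 mul1r.
  have [<-|neq_il] := eqVneq i l.
    by rewrite Zn_neq1 subr0 mulr1; apply: torus_rel_same tf _ _ _.
  have [def_i|neq_il1] := eqVneq i (l + 1).
    have := torus_rel_prev tf i lekm; rewrite {2 3}def_i addrK => rel.
    exact: rel.
  rewrite subrr mulr0; apply/qcomm_comm/(torus_rel_comm tf) => //.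
    have neq_j : (j.+1 == j) = false by lia.
    rewrite /listed_pair /= eqxx neq_j /= (eq_sym l i) (negPf neq_il) /=.
    by rewrite (eq_sym l) subr_eq (negPf neq_il1).
  have [neq1 neq2] : (j == j.+2) = false /\ (j == j.+1) = false by lia.
  by rewrite /listed_pair /= neq1 neq2.
rewrite mul0r add0r; have [def_k|neq_kj] := eqVneq k j.
  rewrite {k lejk neq_kj1 lekm}def_k mul1r.
  have [->|neq_il] := eqVneq i (l + 1).
    rewrite -[_ == l - 1]negbK (eq_sym _ (l - 1)) Zn_neq2 subr0 mulr1.
    have /qcomm_sym : qcomm e (- 2) (z j l) (z j (l + 1)).
      exact: torus_rel_row tf _ _ _.
    by rewrite opprK; apply.
  have [->|neq_il1] := eqVneq i (l - 1).
    have := torus_rel_row tf (l - 1) lejm; rewrite subrK => rel.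
    exact: rel.
  rewrite subrr mulr0; apply/qcomm_comm/(torus_rel_comm tf) => //.
    have neq_j : (j == j.+1) = false by lia.
    by rewrite /listed_pair /= neq_j eqxx -Zn_eqB1 (negPf neq_il1).
  have neq_j : (j == j.+1) = false by lia.
  by rewrite /listed_pair /= neq_j eqxx (negPf neq_il).
rewrite mul0r mulr0; apply/qcomm_comm/(torus_rel_comm tf) => //.
  by rewrite /listed_pair /= (negPf neq_kj1) (negPf neq_kj).
have [neq1 neq2] : (j == k.+1) = false /\ (j == k) = false by lia.
by rewrite /listed_pair /= neq1 neq2.
Qed.


Lemma Zn_natr_neq0 s : (0 < s < n)%N -> s%:R != 0 :> 'Z_n.
Proof.
case/andP=> s_gt0 lt_sn; apply/eqP => /(congr1 (@nat_of_ord _)).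
rewrite (val_Zp_nat n_gt1) modn_small // => s0; by rewrite s0 in s_gt0.
Qed.

(** * Partial column products *)

(** The rows are multiplied in decreasing order, from row [m] to row [k]. *)
Definition column k i : S := \prod_(l <- rev (index_iota k m.+1)) u l i.
Local Notation X := column.

Lemma columnS k i : (k <= m)%N -> X k i = X k.+1 i * u k i.
Proof.
move=> lekm; rewrite /column /index_iota -[(m.+1 - k)%N]prednK ?subn_gt0 //=.
by rewrite rev_cons big_rcons /= subnS.
Qed.

Lemma column_out i : X m.+1 i = 1.
Proof. by rewrite /column /index_iota subnn big_nil. Qed.

Lemma column_unit k i : (k <= m.+1)%N -> X k i \is a GRing.unit.
Proof.
move: k; apply: downward_ind => [|k ltkm IHk].
  by rewrite column_out unitr1.
by rewrite columnS // unitrMr ?gen_unit.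
Qed.

Definition column_weight k i j l : int := \sum_(k <= h < m.+1) weight h i j l.

Lemma column_qcomm k i j l : (k <= m.+1)%N ->
  (j <= m)%N -> qcomm e (column_weight k i j l) (X k i) (u j l).
Proof.
move=> lekm lejm; move: k lekm; apply: downward_ind => [|k ltkm IHk].
  by rewrite column_out /column_weight big_geq //; apply: qcomm1.
rewrite columnS // /column_weight big_ltn // addrC.
by apply: qcommM => //; apply: gen_qcomm.
Qed.

Lemma sum_column_weight k j l : \sum_(i : 'Z_n) column_weight k i j l = 0.
Proof. by rewrite exchange_big big1 //= => h _; apply: sum_weight. Qed.

(** A holonomy involves all the columns equally, so its weight is a sum of total
    row weights. *)
Lemma holonomy_column_comm k i j l : (k <= m.+1)%N ->
  (j <= m)%N -> GRing.comm (holonomy (X k) i) (u j l).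
Proof.
move=> lekm lejm; apply/(qcomm_comm e).
have := qcomm_prod (N := n) eU eC
  (fun t _ => column_qcomm (i - t%:R) l lekm lejm).
rewrite (sum_Zn_rev n_gt1 (fun i => column_weight k i j l)).
by rewrite sum_column_weight.
Qed.

Definition word j N i : S := \prod_(0 <= l < N) u j (i + l%:R).

Lemma word_full_comm j i k l : (j <= m)%N -> (k <= m)%N ->
  GRing.comm (word j n i) (u k l).
Proof.
move=> lejm lekm; apply/(qcomm_comm e).
have := qcomm_prod (N := n) eU eC (fun t _ => gen_qcomm (i + t%:R) l lejm lekm).
by rewrite (sum_Zn_shift n_gt1 (fun i => weight j i k l)) sum_weight.
Qed.

Lemma column_comm_of_gen k i s :
  (forall h, (k <= h <= m)%N -> GRing.comm s (u h i)) -> GRing.comm s (X k i).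
Proof.
have [lekm|ltmk] := leqP k m.+1; last first.
  move=> _; rewrite /column /index_iota.
  have -> : (m.+1 - k = 0)%N by lia.
  by rewrite big_nil; apply: commr1.
move: k lekm; apply: downward_ind => [|k ltkm IHk] sC.
  by rewrite column_out; apply: commr1.
rewrite columnS //; apply: commrM; last by apply: sC; rewrite leqnn.
by apply: IHk => h /andP[lekh lehm]; apply: sC; rewrite ltnW.
Qed.

(** Only rows [j - 1], [j] and [j + 1] contribute to the weight of a column
    against row [j], and the contributions of a column that contains all three
    of them cancel. *)
Lemma column_weight_above j k i l : (j.+1 < k)%N -> column_weight k i j l = 0.
Proof.
move=> ltjk; rewrite /column_weight big1_seq // => h /andP[_].
rewrite mem_index_iota /weight => /andP[lekh _].
have [-> [-> ->]] :
    (j == h.+1) = false /\ (j == h) = false /\ (h == j.+1) = false by lia.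
by rewrite !mul0r.
Qed.

Lemma column_weight_next j i l : (j < m)%N ->
  column_weight j.+1 i j l = 2 * ((i == l - 1)%:R - (i == l)%:R).
Proof.
move=> ltjm; rewrite /column_weight big_ltn // -/(column_weight j.+2 i j l).
rewrite column_weight_above // addr0 /weight eqxx.
have [-> ->] : (j == j.+2) = false /\ (j == j.+1) = false by lia.
by rewrite !mul0r !add0r mul1r.
Qed.

Lemma column_weight_row j i l : (j < m)%N ->
  column_weight j i j l = 2 * ((i == l + 1)%:R - (i == l)%:R).
Proof.
move=> ltjm; rewrite /column_weight big_ltn ?(ltnW ltjm) //; last by lia.
rewrite -/(column_weight j.+1 i j l) column_weight_next // /weight eqxx.
have -> : (j == j.+1) = false by lia.
by rewrite !mul0r add0r addr0 mul1r -mulrDr addrA subrK.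
Qed.

Lemma column_weight_below j i l : (j.+1 < m)%N -> column_weight j i j.+1 l = 0.
Proof.
move=> ltjm; rewrite /column_weight big_ltn; last by lia.
rewrite -/(column_weight j.+1 i j.+1 l) column_weight_row // /weight eqxx.
have [-> ->] : (j.+1 == j) = false /\ (j == j.+2) = false by lia.
by rewrite !mul0r !addr0 mul1r -mulrDr addrA subrK subrr mulr0.
Qed.


(** * The series alpha of one row *)

Lemma cyclic_shift (c w : S) :
  c \is a GRing.unit -> GRing.comm (c * w) c -> w * c = c * w.
Proof. by move=> cU cwC; apply: (mulrI cU); rewrite mulrA [LHS]cwC mulrA. Qed.

Lemma wordS j N i : word j N.+1 i = u j i * word j N (i + 1).
Proof.
rewrite /word big_nat_recl //= mulr0n addr0; congr (_ * _).
by apply: eq_bigr => l _; rewrite -[l.+1]addn1 natrD [_ + 1]addrC addrA.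
Qed.

Lemma wordSr j N i : word j N.+1 i = word j N i * u j (i + N%:R).
Proof. by rewrite /word big_nat_recr. Qed.

Lemma word_full_shift j i : (j <= m)%N -> word j n (i + 1) = word j n i.
Proof.
move=> lejm; have wC := word_full_comm i i lejm lejm.
have wordE l : word j n l = word j n.-1.+1 l by rewrite prednK // (ltnW n_gt1).
have wrap : i + 1 + n.-1%:R = i.
  by rewrite -addrA nat1r prednK ?(ltnW n_gt1) // pchar_Zp ?addr0.
rewrite !wordE wordSr wrap wordS; apply: cyclic_shift; first exact: gen_unit.
by rewrite -wordS -wordE.
Qed.

Lemma alpha_word j i : alpha e z j i = \sum_(0 <= N < n) word j N i.
Proof.
rewrite /alpha (big_ltn (ltnW n_gt1)) [word j 0 i]big_nil; congr (_ + _).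
apply: eq_bigr => N _; rewrite /word; elim: N => [|N IHN].
  by rewrite expr0 !big_nil mulr1.
rewrite !big_nat_recr //= -IHN exprSr !genE -!mulrA; congr (_ * _).
by rewrite mulrA eC -mulrA.
Qed.

Lemma comm_alpha j i s :
  (forall l, GRing.comm s (u j l)) -> GRing.comm s (alpha e z j i).
Proof.
move=> sC; rewrite alpha_word; apply: commr_sum => N _.
by apply: commr_prod => l _; apply: sC.
Qed.

Section Row.

Variable j : nat.
Hypothesis ltjm : (j < m)%N.
Local Notation a := (X j.+1).
Local Notation b := (X j).
Local Notation al := (alpha e z j).
Let lejm : (j <= m)%N. Proof. exact: ltnW. Qed.

(** Multiplication by [u j i] shifts the words of [alpha] by one; the only
    defects are the empty word and the full word. *)
Lemma gen_alpha i : u j i * al (i + 1) = al i - 1 + word j n i.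
Proof.
rewrite !alpha_word mulr_sumr; under eq_bigr do rewrite -wordS.
have: \sum_(0 <= N < n.+1) word j N i
    = word j 0 i + \sum_(0 <= N < n) word j N.+1 i by rewrite big_nat_recl.
rewrite big_nat_recr //= [word j 0 i]big_nil => eq_sum.
by rewrite addrAC eq_sum addrC addKr.
Qed.

Lemma comm_adjacent_columns i l : GRing.comm (b (i + 1) * a i) (u j l).
Proof.
apply/(qcomm_comm e).
have := qcommM eU eC (column_qcomm (i + 1) l (leqW lejm) lejm)
                     (column_qcomm i l (leqW ltjm) lejm).
rewrite column_weight_row // column_weight_next // -mulrDr.
by rewrite (inj_eq (addIr 1)) Zn_eqB1 (eq_sym (i + 1)) addrA subrK subrr mulr0.
Qed.

Lemma column_row_comm i l : i != l -> i != l + 1 -> GRing.comm (b i) (u j l).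
Proof.
move=> /negPf neq_il /negPf neq_il1; apply/(qcomm_comm e).
have := column_qcomm i l (leqW lejm) lejm.
by rewrite column_weight_row // neq_il neq_il1.
Qed.

Lemma column_row_prev i : u j (i - 1) * b i = e ^- 2 * (b i * u j (i - 1)).
Proof.
have := column_qcomm i (i - 1) (leqW lejm) lejm.
rewrite column_weight_row // subrK eqxx.
rewrite -{1}[i](subrK 1) eq_sym Zn_neq1 subr0 mulr1.
by move=> /(qcomm_sym eU).
Qed.

(** A word starting at [i + 1] and of length at most [n - 2] stops before
    reaching [u j (i - 1)]. *)
Lemma column_word_comm i N :
  (N.+1 < n)%N -> GRing.comm (b i) (word j N (i + 1)).
Proof.
move=> ltNn; rewrite /word big_seq; apply: commr_prod => l.
rewrite mem_index_iota => /andP[_ ltlN].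
have neq s : (0 < s < n)%N -> i != i + s%:R.
  move=> /Zn_natr_neq0; rewrite eq_sym.
  by rewrite -[X in _ -> is_true (X != _)]addr0 (inj_eq (addrI i)).
by apply: column_row_comm; rewrite -!addrA ?natr1 nat1r; apply: neq; lia.
Qed.

(** Since [a i * u j i = b i], this is [gen_alpha] multiplied by [a i], with
    [b i] moved to the right of [al (i + 1)]. All words of [al (i + 1)] commute
    with [b i] except the longest one, which ends with [u j (i - 1)] and gives the
    factor [e ^- 2]. *)
Lemma alpha_column i :
  a i * al i = a i * (1 - e ^- 2 * word j n i) + al (i + 1) * b i.
Proof.
have def_n : n = n.-2.+2 by lia.
have bE l : a l * u j l = b l by rewrite [RHS]columnS.
have -> : al (i + 1) * b i
    = b i * al (i + 1) + (e ^- 2 - 1) * (a i * word j n i).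
  have last_word : word j n.-1 (i + 1) * b i
      = e ^- 2 * (b i * word j n.-1 (i + 1)).
    have -> : n.-1 = n.-2.+1 by lia.
    rewrite wordSr.
    have -> : i + 1 + n.-2%:R = i - 1.
      apply/eqP; rewrite eq_sym subr_eq -addrA natr1 -addrA nat1r -def_n.
      by rewrite pchar_Zp // addr0.
    rewrite -mulrA column_row_prev mulrA -(comm_exprz eC (-2)) -!mulrA.
    congr (_ * _); rewrite mulrA -column_word_comm ?mulrA //; lia.
  have aword : a i * word j n i = b i * word j n.-1 (i + 1).
    have -> : word j n i = word j n.-1.+1 i by rewrite prednK // (ltnW n_gt1).
    by rewrite wordS mulrA bE.
  have al_split : al (i + 1) = \sum_(0 <= N < n.-1) word j N (i + 1)
                               + word j n.-1 (i + 1).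
    by rewrite alpha_word -big_nat_recr // prednK // (ltnW n_gt1).
  have sumC : GRing.comm (b i) (\sum_(0 <= N < n.-1) word j N (i + 1)).
    rewrite big_seq; apply: commr_sum => N.
    rewrite mem_index_iota => /andP[_ ltN].
    by apply: column_word_comm; lia.
  rewrite aword al_split mulrDl mulrDr last_word mulrBl mul1r -sumC -addrA.
  by congr (_ + _); rewrite addrC subrK.
have -> : b i * al (i + 1) = a i * (al i - 1 + word j n i).
  by rewrite -gen_alpha mulrA bE.
have qa : GRing.comm (e ^- 2) (a i) := comm_exprz eC (-2) _.
rewrite mulrBl mul1r (mulrA (e ^- 2)) qa -(mulrA (a i)).
rewrite -mulrBr -!mulrDr; congr (_ * _); set v := e ^- 2 * _.
rewrite -[_ + _ + (v - _)]addrA [word _ _ _ + _]addrC subrK.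
by rewrite [RHS]addrC -addrA [v + (1 - v)]addrC !subrK.
Qed.

(** This rewrites the image of [X j.+1] under the R-matrix of row [j] in a form
    that can be added to the image of [X j]. *)
Lemma alpha_column_next i :
  u j (i + 1) * a i * al (i + 2)
    = (al (i + 1) - (1 - e ^- 2 * word j n i)) * a i.
Proof.
apply: (mulrI (column_unit (i + 1) (leqW ltjm))).
have bE l : a l * u j l = b l by rewrite [RHS]columnS.
rewrite 2!(mulrA (a (i + 1))) bE (comm_alpha (i + 2) (comm_adjacent_columns i)).
rewrite [RHS]mulrA mulrBr alpha_column word_full_shift // addrAC subrr add0r.
by rewrite mulrA -(addrA i).
Qed.

End Row.

(** * The R-matrix in column coordinates *)

Section RMatrix.

(* The row is j0 + 1, so that the previous row is j0. *)
Variables (j0 : nat) (R : {rmorphism S -> S}).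
Local Notation j := j0.+1.
Hypotheses (ltjm : (j < m)%N) (hR : quantum_R_matrix m e z j R).
Local Notation a := (X j.+1).
Local Notation b := (X j).
Local Notation al := (alpha e z j).
Hypothesis alU : forall i, al i \is a GRing.unit.
Let lejm : (j <= m)%N. Proof. exact: ltnW. Qed.

Lemma R_gen_row i :
  R (u j i) = e ^+ 2 * ((al (i + 2))^-1 * (u j (i + 1))^-1 * al i).
Proof.
rewrite !genE rmorphM /= (R_q hR) (R_mid hR) invrM ?(torus_y_unit tf) //.
have eVC s : GRing.comm e^-1 s by apply/commr_sym/commrV/commr_sym.
rewrite expr2 -[RHS]mulrA -(eVC (z _ _)^-1) (mulrA (al _)^-1) -eVC.
by rewrite -!mulrA mulVKr.
Qed.

Lemma mulr_eCA s t : s * (e * t) = e * (s * t).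
Proof. by rewrite mulrA -(eC s) -mulrA. Qed.

Lemma R_gen_prev i : R (u j0 i) = (al i)^-1 * (u j i * u j0 i) * al (i + 1).
Proof.
rewrite !genE rmorphM /= (R_q hR) (R_prev hR) /=.
by rewrite (mulr_eCA (e * _)) (mulr_eCA (al _)^-1) -[RHS]mulrA.
Qed.

Lemma R_gen_next i :
  R (u j.+1 i) = (al (i + 1))^-1 * (u j (i + 1) * u j.+1 i) * al (i + 2).
Proof.
rewrite !genE rmorphM /= (R_q hR) (R_next hR) /=.
by rewrite (mulr_eCA (e * _)) (mulr_eCA (al _)^-1) -[RHS]mulrA.
Qed.

Lemma R_gen_other k i :
  (k <= m)%N -> k \notin [:: j0; j; j.+1] -> R (u k i) = u k i.
Proof.
by move=> lekm kP; rewrite !genE rmorphM /= (R_q hR) (R_other hR).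
Qed.

Lemma R_column_above k i : (j.+1 < k)%N -> R (X k i) = X k i.
Proof.
move=> ltjk; rewrite /column rmorph_prod big_seq [RHS]big_seq.
apply: eq_bigr => h; rewrite mem_rev mem_index_iota => /andP[lekh ltmh].
by apply: R_gen_other => //; rewrite !inE; lia.
Qed.

Lemma column_above_alpha i l : GRing.comm (X j.+2 i) (al l).
Proof.
apply: comm_alpha => h; apply/(qcomm_comm e).
have := column_qcomm i h (ltjm : (j.+2 <= m.+1)%N) lejm.
by rewrite column_weight_above.
Qed.

Lemma column_above_gen i l : GRing.comm (X j.+2 i) (u j l).
Proof.
apply/(qcomm_comm e).
have := column_qcomm i l (ltjm : (j.+2 <= m.+1)%N) lejm.
by rewrite column_weight_above.
Qed.

Lemma R_column_next i :
  R (a i) = (al (i + 1))^-1 * (u j (i + 1) * a i * al (i + 2)).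
Proof.
rewrite columnS // rmorphM /= R_column_above // R_gen_next -!mulrA mulrA.
rewrite (commrV (column_above_alpha _ _)) -!mulrA; congr (_ * _).
by rewrite !mulrA column_above_gen.
Qed.

Lemma R_column_row i : R (b i) = (al (i + 1))^-1 * (a i * al i).
Proof.
rewrite [b i]columnS // rmorphM /= R_column_next R_gen_row.
have e2C s : GRing.comm (e ^+ 2) s := comm_exprz eC 2 s.
have au : a i * u j (i + 1) = e ^+ 2 * (u j (i + 1) * a i).
  have := column_qcomm i (i + 1) (leqW ltjm) lejm.
  by rewrite column_weight_next // addrK eqxx Zn_neq1 subr0 mulr1.
rewrite -(mulrA (al _)^-1); congr (_ * _).
rewrite mulrA -e2C (mulrA (e ^+ 2)) -au -!mulrA mulVKr // mulVKr //.
exact: gen_unit.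
Qed.

(** The part [1 - e ^- 2 * word j n i] of [alpha_column] commutes with [a i] and
    cancels with the one of [alpha_column_next]. *)
Lemma R_column_sum i : R (b i) + R (a i) = b i + a i.
Proof.
rewrite R_column_row R_column_next -mulrDr alpha_column_next //.
have aW : GRing.comm (1 - e ^- 2 * word j n i) (a i).
  apply/commr_sym/commrB; first exact: commr1.
  apply: commrM; first exact/commr_sym/(comm_exprz eC (-2)).
  apply/commr_sym/column_comm_of_gen => h /andP[_ lehm].
  exact: word_full_comm.
rewrite alpha_column // -aW; move: (1 - _) => w.
by rewrite mulrBl [w * _ + _]addrC addrACA subrr addr0 -mulrDr mulKr.
Qed.

Lemma R_column_mul i : R (b (i + 1)) * R (a i) = b (i + 1) * a i.
Proof.
rewrite R_column_row R_column_next -!mulrA mulVKr // -(addrA i).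
rewrite (mulrA (a (i + 1))) -columnS // (mulrA (b (i + 1))).
by rewrite (comm_alpha _ (comm_adjacent_columns ltjm i)) mulKr.
Qed.

Lemma column_below_alpha i l : GRing.comm (X j0 i) (al l).
Proof.
apply: comm_alpha => h; apply/(qcomm_comm e).
have := column_qcomm i h (leqW (ltnW lejm)) lejm.
by rewrite column_weight_below.
Qed.

(** The factors [alpha] produced by rows [j0] and [j] telescope up to a
    conjugation by [alpha], and this column commutes with row [j]. *)
Lemma R_column_prev i : R (X j0 i) = X j0 i.
Proof.
rewrite {1}columnS ?(ltnW lejm) // rmorphM /= R_column_row R_gen_prev.
rewrite -!mulrA mulVKr // (mulrA (a i)) -columnS //.
by rewrite (mulrA (b i)) -columnS ?(ltnW lejm) // column_below_alpha mulKr.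
Qed.

Lemma R_column_below k i : (k < j)%N -> R (X k i) = X k i.
Proof.
rewrite ltnS; move: k; apply: downward_ind => [|k ltkj IHk].
  exact: R_column_prev.
have lekm : (k <= m)%N by lia.
rewrite columnS // rmorphM /= IHk R_gen_other // !inE; lia.
Qed.

Lemma R_column_other k i : k != j -> k != j.+1 -> R (X k i) = X k i.
Proof.
move=> neqj neqj1; have [ltkj|lejk] := ltnP k j; first exact: R_column_below.
by apply: R_column_above; lia.
Qed.

End RMatrix.

End TorusFamily.

(** * The torus and its skew field of fractions *)

Lemma torus_family_map (n m : nat) (S S' : unitRingType) (e : S)
    (z : nat -> 'Z_n -> S) (f : {rmorphism S -> S'}) :
    torus_family m e z -> (forall s, GRing.comm (f e) s) ->
  torus_family m (f e) (fun j i => f (z j i)).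
Proof.
case=> eU _ zU r1 r2 r3 r4 fC.
have fV : f (e ^- 2) = f e ^- 2 by rewrite rmorphV ?unitrX //= rmorphXn.
split=> //.
- exact: rmorph_unit.
- by move=> j i lejm; apply: rmorph_unit; apply: zU.
- by move=> j i ltjm; rewrite -!rmorphM r1 // !rmorphM.
- by move=> j i ltjm; rewrite -!rmorphM r2 // !rmorphM fV.
- by move=> j i ltjm; rewrite -!rmorphM r3 // !rmorphM fV.
- by move=> j i k l lej lek n1 n2; rewrite /GRing.comm -!rmorphM r4.
Qed.

Section Conjugation.

Variables (T S : unitRingType) (f : {rmorphism T -> S}) (w : S).
Hypothesis wU : w \is a GRing.unit.

Definition conj_morph (t : T) : S := w * f t * w^-1.

Fact conj_morph_additive : zmod_morphism conj_morph.
Proof. by move=> s t; rewrite /conj_morph rmorphB mulrBr mulrBl. Qed.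

Fact conj_morph_multiplicative : monoid_morphism conj_morph.
Proof.
split=> [|s t]; first by rewrite /conj_morph rmorph1 mulr1 divrr.
by rewrite /conj_morph rmorphM !mulrA mulrVK.
Qed.

Definition conj_rmorphism : {rmorphism T -> S} :=
  HB.pack conj_morph
    (GRing.isZmodMorphism.Build T S conj_morph conj_morph_additive)
    (GRing.isMonoidMorphism.Build T S conj_morph conj_morph_multiplicative).

End Conjugation.

(** Moving the first factor of a product that commutes with it to the end does
    not change the product. *)
Lemma holonomy_shift (n : nat) (S : unitRingType) (v : 'Z_n -> S) (i : 'Z_n) :
    (1 < n)%N -> v i \is a GRing.unit -> GRing.comm (holonomy v i) (v i) ->
  holonomy v (i - 1) = holonomy v i.
Proof.
move=> n_gt1 viU; pose w := \prod_(0 <= l < n.-1) v (i - 1 - l%:R).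
have prodE (F : nat -> S) :
    \prod_(0 <= l < n) F l = \prod_(0 <= l < n.-1.+1) F l.
  by rewrite prednK // ltnW.
have hol_i : holonomy v i = v i * w.
  rewrite /holonomy prodE big_nat_recl //= subr0; congr (_ * _).
  by apply: eq_bigr => l _; rewrite -nat1r opprD addrA.
have -> : holonomy v (i - 1) = w * v i.
  rewrite /holonomy prodE big_nat_recr //=; congr (_ * v _).
  by rewrite -addrA -opprD nat1r prednK ?(ltnW n_gt1) // pchar_Zp // subr0.
by rewrite hol_i; apply: cyclic_shift.
Qed.

Section Fractions.

Variables (n m : nat) (T Y : unitRingType) (q : T) (x : nat -> 'Z_n -> T).
Variable iota : {rmorphism T -> Y}.
Hypotheses (hT : quantum_torus m q x) (hY : skew_field_of_fractions iota).

Lemma fraction_central (s : Y) :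
  (forall t, GRing.comm s (iota t)) -> forall r, GRing.comm s r.
Proof.
move=> sC r; have [_ _ /(_ r)[t [t' [_ ->]]]] := hY.
by apply: commrM; last apply: commrV.
Qed.

Lemma iota_q_central r : GRing.comm (iota q) r.
Proof.
apply: fraction_central => t.
by rewrite /GRing.comm -!rmorphM (torus_q_central hT.1).
Qed.

Lemma torus_family_fraction : torus_family m (iota q) (fun j i => iota (x j i)).
Proof. exact: torus_family_map hT.1 iota_q_central. Qed.

Lemma torus_morphism_eq (S : unitRingType) (f g : {rmorphism T -> S}) :
    (forall s, GRing.comm (f q) s) -> f q = g q ->
    (forall j i, (j <= m)%N -> f (x j i) = g (x j i)) ->
  f =1 g.
Proof.
move=> fC fg_q fg_x t.
have [h _ uniq_h] := hT.2 _ _ _ (torus_family_map hT.1 fC).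
transitivity (h t); first by apply: uniq_h.
by symmetry; apply: uniq_h; split=> [|j i lejm]; rewrite ?fg_q ?fg_x.
Qed.

(** Conjugation by [w] fixes the generators, so it is trivial by the uniqueness
    in the universal property of the torus. *)
Lemma central_of_comm_gens (w : Y) :
    w \is a GRing.unit ->
    (forall j i, (j <= m)%N -> GRing.comm w (iota (x j i))) ->
  forall r, GRing.comm w r.
Proof.
move=> wU wC; apply: fraction_central => t.
have wCK r : GRing.comm w r -> w * r * w^-1 = r by move=> ->; rewrite mulrK.
have fixt : iota t = conj_rmorphism iota wU t.
  apply: torus_morphism_eq t; first exact: iota_q_central.
    by rewrite /= /conj_morph wCK //; apply/commr_sym/iota_q_central.
  by move=> j i lejm; rewrite /= /conj_morph wCK //; apply: wC.
by rewrite /GRing.comm {2}fixt /= /conj_morph mulrVK.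
Qed.

Lemma fraction_morphism_eq (f g : {rmorphism Y -> Y}) :
    f (iota q) = iota q -> g (iota q) = iota q ->
    (forall j i, (j <= m)%N -> f (iota (x j i)) = g (iota (x j i))) ->
  f =1 g.
Proof.
move=> fq gq fg_x r; have [unitY inj_iota /(_ r)[t [t' [nz_t' ->]]]] := hY.
have fg_iota s : f (iota s) = g (iota s).
  apply: (torus_morphism_eq (f := f \o iota) (g := g \o iota)) => //=.
    by move=> s'; rewrite fq; apply: iota_q_central.
  by rewrite fq gq.
have t'U : iota t' \is a GRing.unit.
  by apply: unitY; rewrite -(rmorph0 iota) (inj_eq inj_iota).
by rewrite !rmorphM !rmorphV // !fg_iota.
Qed.

(** In a commutative ring, with [e = 1], the defining relations hold for any
    units. *)
Lemma torus_point : exists f : {rmorphism T -> rat},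
  f q = 1 /\ forall j i, (j <= m)%N -> f (x j i) = 2.
Proof.
have tf : torus_family m (1 : rat) (fun (_ : nat) (_ : 'Z_n) => 2 : rat).
  by split=> *; rewrite ?expr1n ?invr1 ?mul1r //; apply: mulrC.
by have [f [fq fx] _] := hT.2 _ _ _ tf; exists f.
Qed.

Hypothesis n_gt2 : (2 < n)%N.
Let e := iota q.
Let z j i := iota (x j i).
Let tf : torus_family m e z := torus_family_fraction.
Local Notation X := (column m e z).

(** At the rational point [alpha] is a sum of positive terms. *)
Lemma alpha_unit j i : (j <= m)%N -> alpha e z j i \is a GRing.unit.
Proof.
move=> lejm; have [unitY inj_iota _] := hY; apply: unitY.
have -> : alpha e z j i = iota (alpha q x j i).
  rewrite /alpha rmorphD rmorph1 rmorph_sum; congr (_ + _).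
  by apply: eq_bigr => k _; rewrite rmorphM rmorphXn rmorph_prod.
have [f [fq fx]] := torus_point.
rewrite -(rmorph0 iota) (inj_eq inj_iota); apply/eqP => /(congr1 f)/eqP.
rewrite rmorph0 /alpha rmorphD rmorph1 rmorph_sum gt_eqF //.
rewrite ltr_wpDr // sumr_ge0 // => k _.
rewrite rmorphM rmorphXn fq expr1n mul1r rmorph_prod prodr_ge0 // => l _.
by rewrite fx.
Qed.

(** * Holonomies *)

Lemma holonomy_unit k i : (k <= m.+1)%N -> holonomy (X k) i \is a GRing.unit.
Proof. by move=> lekm; apply: unitr_prod => l _; apply: column_unit. Qed.

Lemma holonomy_central k i r : (k <= m.+1)%N -> GRing.comm (holonomy (X k) i) r.
Proof.
move=> lekm; apply: central_of_comm_gens => [|j l lejm].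
  exact: holonomy_unit.
have := holonomy_column_comm n_gt2 tf i l lekm lejm; rewrite genE => hC.
have -> : iota (x j l) = e^-1 * (e * z j l).
  by rewrite mulKr // (torus_q_unit tf).
by apply: commrM hC; apply/commrV/commr_sym/iota_q_central.
Qed.

Lemma holonomy_const k i : (k <= m.+1)%N -> holonomy (X k) i = holonomy (X k) 0.
Proof.
move=> lekm; have n_gt1 := ltnW n_gt2; rewrite -(natr_Zp i).
elim: (val i) => // t <-; rewrite -(holonomy_shift n_gt1 (i := t.+1%:R)).
- by rewrite -natr1 addrK.
- exact: column_unit.
exact: holonomy_central.
Qed.


(** At the rational point the holonomy of row [k] is
    [2 ^+ ((m + 1 - k) * n)]. *)
Lemma holonomy_neq k l i i' :
  (k < l <= m)%N -> holonomy (X k) i != holonomy (X l) i'.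
Proof.
move=> /andP[ltkl lelm]; have [_ inj_iota _] := hY.
have [f [fq fx]] := torus_point.
have holE h j : (h <= m)%N -> exists2 t, holonomy (X h) j = iota t
                                    & f t = 2 ^+ (m.+1 - h) ^+ n.
  move=> lehm; exists (holonomy (column m q x h) j).
    rewrite /holonomy rmorph_prod; apply: eq_bigr => d _.
    rewrite /column rmorph_prod.
    by apply: eq_bigr => c _; rewrite !genE rmorphM.
  rewrite /holonomy rmorph_prod -[in RHS](subn0 n) -prodr_const_nat.
  apply: eq_bigr => d _; rewrite /column rmorph_prod.
  rewrite -prodr_const_nat -[RHS]big_rev big_seq [RHS]big_seq.
  apply: eq_bigr => c; rewrite mem_rev mem_index_iota => /andP[_ ltcm].
  by rewrite genE rmorphM fq mul1r fx.
have [t -> ft] := holE k i (leq_trans (ltnW ltkl) lelm).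
have [t' -> ft'] := holE l i' lelm.
rewrite (inj_eq inj_iota); apply/eqP => /(congr1 f); rewrite ft ft' -!exprM.
have n_gt0 : (0 < n)%N by lia.
move/eqP; rewrite -!natrX eqr_nat eqn_exp2l // eqn_pmul2r //; lia.
Qed.

Lemma qprop_column k l i i' : (k <= m.+1)%N -> (l <= m.+1)%N ->
  qprop e (X k i) (X l i').
Proof.
move=> lekm; move: l; apply: downward_ind => [|l ltlm IHl].
  rewrite column_out; exact: (qprop_sym (torus_q_unit tf) (qprop1 e _)).
rewrite [X l i']columnS //; apply: (qprop_sym (torus_q_unit tf)).
apply: (qpropM (torus_q_unit tf) (torus_q_central tf)).
  exact: (qprop_sym (torus_q_unit tf)).
apply: (qprop_sym (torus_q_unit tf)).
by exists (column_weight m k i l i'); apply: column_qcomm.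
Qed.

Section RMatrixHolonomy.

Variables (j0 : nat) (R : {rmorphism Y -> Y}).
Local Notation j := j0.+1.
Hypotheses (ltjm : (j < m)%N) (hR : quantum_R_matrix m e z j R).
Local Notation al := (alpha e z j).
Let alU i : al i \is a GRing.unit. Proof. exact/alpha_unit/ltnW. Qed.
Let n_gt1 : (1 < n)%N. Proof. exact: ltnW. Qed.

(** The factors [alpha] telescope around the cycle and leave a conjugation of a
    central element. *)
Lemma R_holonomy_row i : R (holonomy (X j) i) = holonomy (X j.+1) i.
Proof.
have tele N : \prod_(0 <= l < N) R (X j (i - l%:R))
    = (al (i + 1))^-1 * \prod_(0 <= l < N) X j.+1 (i - l%:R)
        * al (i - N%:R + 1).
  elim: N => [|N IHN]; first by rewrite !big_nil mulr1 subr0 mulVr.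
  rewrite !big_nat_recr //= IHN (R_column_row n_gt2 tf ltjm hR) //.
  rewrite -!mulrA mulVKr //; congr (_ * (_ * (_ * al _))).
  by rewrite -natr1 opprD addrA subrK.
rewrite {1}/holonomy rmorph_prod tele -/(holonomy _ i) pchar_Zp // subr0.
by rewrite -mulrA holonomy_central ?mulKr // ltnW.
Qed.

(** The images of [X j.+1] do not telescope. Instead, up to a power of [e] the
    product of the holonomies of rows [j] and [j + 1] is a product of elements
    [X j (i + 1) * X j.+1 i], so it is fixed by [R]. *)
Lemma R_holonomy_next i : R (holonomy (X j.+1) i) = holonomy (X j) i.
Proof.
have lejm : (j <= m.+1)%N by lia.
pose p := \prod_(0 <= l < n) (X j (i + 1 - l%:R) * X j.+1 (i - l%:R)).
have [d def_p] : exists d : int,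
    p = e ^ d * (holonomy (X j) (i + 1) * holonomy (X j.+1) i).
  apply: (qprop_prod_mul (torus_q_unit tf) (torus_q_central tf) n
     (s := fun l => X j (i + 1 - l%:R))
     (t := fun l => X j.+1 (i - l%:R))) => k l.
  by apply: qprop_column; lia.
have Rp : R p = p.
  rewrite rmorph_prod; apply: eq_bigr => l _; rewrite rmorphM /= addrAC.
  exact: (R_column_mul n_gt2 tf ltjm hR).
have edU : e ^ d \is a GRing.unit by apply: unitrXz; apply: torus_q_unit tf.
have Red : R (e ^ d) = e ^ d by rewrite rmorphXz ?(torus_q_unit tf) // (R_q hR).
move: Rp; rewrite def_p !rmorphM /= Red R_holonomy_row => /(mulrI edU).
have constj l l' : holonomy (X j) l = holonomy (X j) l'.
  by rewrite holonomy_const // [RHS]holonomy_const.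
have constj1 : holonomy (X j.+1) (i + 1) = holonomy (X j.+1) i.
  by rewrite holonomy_const ?[RHS]holonomy_const //; lia.
rewrite (constj (i + 1) i) constj1 [RHS]holonomy_central //.
by apply: mulrI; apply: holonomy_unit; lia.
Qed.

End RMatrixHolonomy.


(** * Endomorphisms permuting the holonomies *)

(** The transfer operator is required to be preserved after every further
    endomorphism [g]: this expresses that its coefficients are fixed by [f],
    without naming them, and is stable under composition. The factors are the
    rows [1] to [m] of column products; row [0] is invariant by itself, and is
    needed to recover the generators of that row. *)
Record permutes_rows (s : 'S_m) (f : {rmorphism Y -> Y}) : Prop :=
  PermutesRows {
  permutes_q : f e = e;
  permutes_column0 : forall i, f (X 0 i) = X 0 i;
  permutes_transfer : forall (g : {rmorphism Y -> Y}) psi,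
    transfer (fun k i => g (f (X k.+1 i))) m psi
      =1 transfer (fun k i => g (X k.+1 i)) m psi;
  permutes_holonomy : forall (k : 'I_m) i,
    f (holonomy (X k.+1) i) = holonomy (X (s k).+1) i
}.

Lemma permutes_rows1 : permutes_rows 1%g idfun.
Proof. by split=> //= k i; rewrite perm1. Qed.

Lemma permutes_rowsM s t f g :
  permutes_rows s f -> permutes_rows t g -> permutes_rows (s * t)%g (g \o f).
Proof.
move=> [fq f0 fT fH] [gq g0 gT gH]; split=> /=.
- by rewrite fq.
- by move=> i; rewrite f0.
- by move=> h psi l; rewrite -(gT h psi l) -(fT (h \o g) psi l).
- by move=> k i; rewrite fH gH permM.
Qed.

(** The images of the rows under [f] and [g] are two factorizations of the same
    operator with the same holonomies in the same order; and the rows generate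
    the skew field together with [q]. *)
Theorem permutes_rows_inj s f g :
  permutes_rows s f -> permutes_rows s g -> f =1 g.
Proof.
case=> fq f0 fT fH [gq g0 gT gH].
have [unitY _ _] := hY.
have eq_row k i : (k <= m)%N -> f (X k i) = g (X k i).
  case: k => [|k] lekm; first by rewrite f0 g0.
  have holM (h : {rmorphism Y -> Y}) l i' :
      holonomy (fun d => h (X l.+1 d)) i' = h (holonomy (X l.+1) i').
    by rewrite /holonomy rmorph_prod.
  move: i; apply: (transfer_unique (ltnW n_gt2) unitY
    (x := fun k i => f (X k.+1 i)) (y := fun k i => g (X k.+1 i))
    _ _ _ _ _ _ lekm).
  - by move=> l i ltlm; apply/rmorph_unit/column_unit => //; apply: ltnW.
  - by move=> l i ltlm; apply/rmorph_unit/column_unit => //; apply: ltnW.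
  - move=> l i i' ltlm; rewrite !holM (fH (Ordinal ltlm)) (gH (Ordinal ltlm)).
    by rewrite holonomy_const ?[RHS]holonomy_const ?ltnS // ltnW.
  - move=> l i r ltlm; rewrite holM (fH (Ordinal ltlm)).
    by apply: holonomy_central; apply: ltnW; rewrite ltnS.
  - move=> k' l i /andP[ltkl ltlm]; have ltkm := ltn_trans ltkl ltlm.
    rewrite !holM (fH (Ordinal ltkm)) (fH (Ordinal ltlm)).
    have: s (Ordinal ltkm) != s (Ordinal ltlm).
      by rewrite (inj_eq perm_inj) -val_eqE /= ltn_eqF.
    rewrite -val_eqE neq_ltn => /orP[lt_s|lt_s].
      by apply: holonomy_neq; rewrite ltnS lt_s ltn_ord.
    by rewrite eq_sym; apply: holonomy_neq; rewrite ltnS lt_s ltn_ord.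
  - by move=> psi t; rewrite (fT idfun) (gT idfun).
have eq_gen j i : (j <= m)%N -> f (gen e z j i) = g (gen e z j i).
  move=> lejm; have Xj1U : X j.+1 i \is a GRing.unit by apply: column_unit.
  have -> : gen e z j i = (X j.+1 i)^-1 * X j i.
    by rewrite [X j i]columnS // mulKr.
  rewrite !rmorphM !rmorphV // (eq_row j) //; congr (_^-1 * _).
  have [ltjm|lemj] := ltnP j m; first exact: eq_row.
  have -> : j = m by lia.
  by rewrite column_out !rmorph1.
apply: fraction_morphism_eq => // j i lejm.
have eU : e \is a GRing.unit := torus_q_unit tf.
have := eq_gen j i lejm; rewrite !genE !rmorphM /= fq gq; exact: mulrI.
Qed.

Lemma R_permutes_rows (a b : 'I_m) (R : {rmorphism Y -> Y}) :
    a.+1 = b :> nat -> quantum_R_matrix m e z b R ->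
  permutes_rows (tperm a b) R.
Proof.
move=> def_b; rewrite -def_b => hR.
have ltam : (a.+1 < m)%N by rewrite def_b.
have alU i : alpha e z a.+1 i \is a GRing.unit by apply/alpha_unit/ltnW.
have R_other k i : k != a.+1 -> k != a.+2 -> R (X k i) = X k i.
  exact: (R_column_other n_gt2 tf ltam hR).
split=> [|i|g psi|k i].
- exact: R_q hR.
- exact: R_other.
- apply: (@eq_transfer_two _ _ _ _ _ a) => // [k ltkm neqa neqa1 i|i|i].
  + by rewrite R_other.
  + by rewrite -!(rmorphD g) (R_column_sum n_gt2 tf ltam hR).
  rewrite -!(rmorphM g); congr (g _).
  have := R_column_mul n_gt2 tf ltam hR alU (i - 1); by rewrite subrK.
have [-> | neq_ka] := eqVneq k a.
  by rewrite tpermL (R_holonomy_row ltam hR) def_b.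
have [-> | neq_kb] := eqVneq k b.
  by rewrite tpermR -def_b (R_holonomy_next ltam hR).
have -> : tperm a b k = k by rewrite tpermD // eq_sym.
rewrite /holonomy rmorph_prod; apply: eq_bigr => l _.
by apply: R_other; rewrite eqSS ?def_b.
Qed.

End Fractions.

(** * Permutations *)

Lemma tperm_braid (I : finType) (a b c : I) : a != b -> b != c -> a != c ->
  (tperm a b * tperm b c * tperm a b = tperm b c * tperm a b * tperm b c)%g.
Proof.
move=> neq_ab neq_bc neq_ac.
have conj (x y u v : I) :
    (tperm u v * tperm x y * tperm u v)%g = tperm (tperm u v x) (tperm u v y).
  by rewrite -tpermJ /conjg tpermV mulgA.
by rewrite !conj tpermR tpermL (tpermD neq_ac) // tpermD 1?eq_sym.
Qed.

Lemma tperm_commute (I : finType) (a b c d : I) :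
    a != c -> a != d -> b != c -> b != d ->
  commute (tperm a b) (tperm c d).
Proof.
move=> neq_ac neq_ad neq_bc neq_bd; apply/commgP/conjg_fixP.
by rewrite tpermJ !tpermD // eq_sym.
Qed.

Lemma adjacent_tperm_ind (m : nat) (P : 'S_m -> Prop) :
    P 1%g -> (forall s t, P s -> P t -> P (s * t)%g) ->
    (forall a b : 'I_m, a.+1 = b :> nat -> P (tperm a b)) ->
  forall s, P s.
Proof.
move=> P1 PM Padj.
have Plt d (a b : 'I_m) : b = (a + d).+1 :> nat -> P (tperm a b).
  elim: d b => [|d IHd] b def_b; first by apply: Padj; rewrite def_b addn0.
  have ltcm : ((a + d).+1 < m)%N by have := ltn_ord b; lia.
  pose c := Ordinal ltcm; have adj : c.+1 = b by rewrite def_b addnS.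
  have -> : tperm a b = (tperm a c ^ tperm c b)%g.
    by rewrite tpermJ tpermL tpermD // -val_eqE /=; lia.
  rewrite /conjg tpermV; have Pcb := Padj _ _ adj.
  by apply: (PM _ _ Pcb); apply: PM => //; apply: IHd.
have Ptperm a b : P (tperm a b).
  case: (ltngtP a b) => [ltab|ltba|/val_inj->]; last by rewrite tperm1.
    by apply: (Plt (b - a.+1)%N); lia.
  by rewrite tpermC; apply: (Plt (a - b.+1)%N); lia.
move=> s; have [ts -> _] := prod_tpermP s.
by apply: big_ind.
Qed.

(** * The symmetric group action *)

Theorem theorem7p6 (n m : nat) (hn : (3 <= n)%N) (hm : (2 <= m)%N)
  (T : unitRingType) (q : T) (x : nat -> 'Z_n -> T)
  (hT : quantum_torus m q x)
  (Y : unitRingType) (iota : {rmorphism T -> Y})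
  (hY : skew_field_of_fractions iota)
  (R : nat -> {rmorphism Y -> Y})
  (hR : forall j : nat, (1 <= j <= m - 1)%N ->
     quantum_R_matrix m (iota q) (fun k i => iota (x k i)) j (R j)) :
  [/\ forall j : nat, (1 <= j <= m - 2)%N ->
        R j \o R j.+1 \o R j =1 R j.+1 \o R j \o R j.+1,
      forall j : nat, (1 <= j <= m - 1)%N -> R j \o R j =1 id,
      forall i j : nat, (1 <= i <= m - 1)%N -> (1 <= j <= m - 1)%N ->
        (i.+1 < j)%N || (j.+1 < i)%N -> R i \o R j =1 R j \o R i
    & exists to : {action 'S_m &-> Y},
        (forall s : 'S_m, exists2 f : {rmorphism Y -> Y},
           f (iota q) = iota q & forall z : Y, to z s = f z) /\
        (forall a b : 'I_m, a.+1 = b :> nat ->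
           forall z : Y, to z (tperm a b) = R b z)].
Proof.
pose permR := permutes_rows q x iota (m := m).
have inj s (f g : {rmorphism Y -> Y}) : permR s f -> permR s g -> f =1 g.
  exact: permutes_rows_inj.
have permRM s t f g : permR s f -> permR t g -> permR (s * t)%g (g \o f).
  exact: permutes_rowsM.
have permR_adj (a b : 'I_m) : a.+1 = b :> nat -> permR (tperm a b) (R b).
  move=> adj; have b_row : (1 <= b <= m - 1)%N by have := ltn_ord b; lia.
  exact: R_permutes_rows adj (hR b b_row).
have permR_row j : (1 <= j <= m - 1)%N ->
    exists a b : 'I_m, [/\ a.+1 = b, b = j :> nat & permR (tperm a b) (R j)].
  case: j => // j j_row; have ltjm : (j.+1 < m)%N by lia.
  exists (Ordinal (ltnW ltjm)), (Ordinal ltjm); split=> //.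
  exact: (permR_adj (Ordinal (ltnW ltjm)) (Ordinal ltjm)).
have neq_ord (a b : 'I_m) : (a < b)%N -> a != b.
  by rewrite -val_eqE ltn_neqAle => /andP[].
split.
- move=> j j_row; have [|a [b [adj_b def_b Pj]]] := permR_row j; first by lia.
  have [|b' [c [adj_c def_c Pj1]]] := permR_row j.+1; first by lia.
  have def_b' : b' = b by apply: val_inj => /=; lia.
  rewrite def_b' in adj_c Pj1.
  pose s := (tperm a b * tperm b c * tperm a b)%g.
  have def_s : s = (tperm b c * tperm a b * tperm b c)%g.
    by apply: tperm_braid; apply: neq_ord; lia.
  apply: (inj s (R j \o R j.+1 \o R j) (R j.+1 \o R j \o R j.+1)).
    rewrite /s -mulgA; apply: (permRM _ _ _ _ Pj _).
    exact: (permRM _ _ _ _ Pj1 Pj).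
  rewrite def_s -mulgA; apply: (permRM _ _ _ _ Pj1 _).
  exact: (permRM _ _ _ _ Pj Pj1).
- move=> j /permR_row[a [b [_ _ Pj]]].
  apply: (inj 1%g (R j \o R j) idfun); last exact: permutes_rows1.
  by rewrite -(tperm2 a b); apply: permRM.
- move=> i j /permR_row[a [b [adj_b def_b Pi]]].
  move=> /permR_row[c [d [adj_d def_d Pj]]] far.
  have neq (u v : 'I_m) : u <> v :> nat -> u != v by rewrite -val_eqE => /eqP.
  apply: (inj (tperm a b * tperm c d)%g (R i \o R j) (R j \o R i)).
    rewrite tperm_commute; try by apply: neq; lia.
    exact: (permRM _ _ _ _ Pj Pi).
  exact: (permRM _ _ _ _ Pi Pj).
have exR s : exists f, permR s f.
  move: s; apply: adjacent_tperm_ind => [|s t [f Pf] [g Pg]|a b /permR_adj Pab].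
  - by exists idfun; apply: permutes_rows1.
  - by exists (g \o f); apply: permRM.
  - by exists (R b).
have [F PF] := fin_all_exists exR.
have F1 z : F 1%g z = z.
  by apply: (inj 1%g (F 1%g) idfun) => //; apply: permutes_rows1.
have FM z s t : F (s * t)%g z = F t (F s z).
  by apply: (inj (s * t)%g _ (F t \o F s)) => //; apply: permRM.
exists (TotalAction (to := fun z s => F s z) F1 FM); split=> [s|a b adj z].
  by exists (F s) => //; apply: permutes_q (PF s).
by apply: (inj (tperm a b)) => //; apply: permR_adj.
Qed.
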